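(* Let $\ell_1,\dots,\ell_r$ be positive integers. Let $\mathcal{U}$ be a cube partition of $\mathbb{N}$ of order $(\ell_1,\dots,\ell_r)$ with equally (upper-) dense partition classes, and let $c_{\mathcal{U}}$ be the cube colouring of $\vec{K}_{\mathbb{N}}$ on $\mathcal{U}$. Then for every $i\in\{1,\dots,r\}$ there is no directed path of length $\ell_i$ in colour $i$ (that is, with all edges of colour $i$), and every directed monochromatic path of colour $r+1$ has upper density at most $\prod_{i=1}^r\frac{1}{\ell_i}$.
   Context: $\mathbb{N}$ denotes the positive integers. $\vec{K}_{\mathbb{N}}$ is the complete symmetric digraph on $\mathbb{N}$: its edges are all ordered pairs $(m,n)$ of distinct positive integers. The upper density of $A\subseteq\mathbb{N}$ is $\bar d(A)=\limsup_{n\to\infty}\frac{|A\cap\{1,\dots,n\}|}{n}$, and the upper density of a path is that of its vertex set. ''Equally (upper-) dense partition classes'' means that all partition classes have the same (upper) density. A directed path is a finite or one-way infinite sequence of distinct vertices $v_1v_2\dots$ together with edges joining consecutive vertices, all oriented in the same direction (all edges $(v_i,v_{i+1})$, or all edges $(v_{i+1},v_i)$). The length of a path is its number of edges. Cube partition: a cube partition of $\mathbb{N}$ of order $(\ell_1,\dots,\ell_r)$ is a partition $\mathcal{U}=(U_{i_1,\dots,i_r})$ of $\mathbb{N}$ indexed by the tuples $(i_1,\dots,i_r)\in\prod_{k=1}^r\{0,\dots,\ell_k-1\}$. Cube colouring: for a cube partition $\mathcal{U}$, the colouring $c_{\mathcal{U}}\colon E(\vec{K}_{\mathbb{N}})\to\{1,\dots,r+1\}$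 is defined as follows. If $m\neq n$ lie in the same class of $\mathcal{U}$, then $(m,n)$ and $(n,m)$ both get colour $r+1$. If $m\in U_{i_1,\dots,i_r}$ and $n\in U_{j_1,\dots,j_r}$ lie in different classes, let $k=\min\{k'\in\{1,\dots,r\}: i_{k'}\neq j_{k'}\}$ and name $m,n$ so that $i_k<j_k$; then $(m,n)$ gets colour $r+1$ and $(n,m)$ gets colour $k$.
   Formalization: ''Equally (upper-) dense'' is taken to mean that every class has a natural density and these are all equal; if only the upper densities agree, the bound can fail (two classes, both of upper density 1). *)

(* Defs.v *)
From mathcomp Require Import all_boot all_order all_algebra.
From mathcomp Require Import all_classical all_reals all_analysis.

Set Implicit Arguments.
Unset Strict Implicit.
Unset Printing Implicit Defensive.

Import Order.TTheory GRing.Theory Num.Theory.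
Import numFieldNormedType.Exports.

Local Open Scope classical_set_scope.
Local Open Scope ring_scope.

Definition posnat : Type := {n : nat | (0 < n)%N}.

(* [posnat_of k] is the positive integer k + 1. *)
Definition posnat_of (k : nat) : posnat := exist _ k.+1 isT.

(* |A /\ {1, ..., n}| / n; the junk value 0 at n = 0 does not affect limits. *)
Definition density_upto (R : realType) (A : set posnat) (n : nat) : R :=
  #|[pred k : 'I_n | `[< A (posnat_of k) >]]|%:R / n%:R.

Definition has_density (R : realType) (A : set posnat) (d : R) : Prop :=
  density_upto R A n @[n --> \oo] --> d.

Definition upper_density (R : realType) (A : set posnat) : \bar R :=
  limn_esup (fun n => (density_upto R A n)%:E).

Definition cube_index (r : nat) (l : 'I_r -> nat) : Type :=
  {dffun forall k : 'I_r, 'I_(l k)}.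

Record cube_partition (r : nat) (l : 'I_r -> nat) := CubePartition {
  cube_class :> cube_index l -> set posnat;
  cube_class_partition :
    classical_sets.partition [set: cube_index l] cube_class [set: posnat] }.

Definition equally_dense (R : realType) (r : nat) (l : 'I_r -> nat)
    (U : cube_partition l) : Prop :=
  exists d : R, forall i : cube_index l, has_density (U i) d.

Lemma cube_class_exists (r : nat) (l : 'I_r -> nat) (U : cube_partition l)
  (m : posnat) : exists i : cube_index l, U i m.
Proof.
have [cU _ _] := cube_class_partition U.
have : [set: posnat] m by [].
by rewrite -cU => -[i _ Uim]; exists i.
Qed.

Definition index_of (r : nat) (l : 'I_r -> nat) (U : cube_partition l)
    (m : posnat) : cube_index l :=
  projT1 (cid (cube_class_exists U m)).

Definition first_difference (r : nat) (l : 'I_r -> nat) (i j : cube_index l)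
    : option 'I_r :=
  [pick k : 'I_r | (i k != j k) &&
                   [forall k' : 'I_r, (i k' != j k') ==> (k <= k')%N]].

(* Colours are counted from 0: the colours 1, ..., r and r + 1 are here
   [colour k] for k : 'I_r, and [last_colour r]. *)
Definition colour (r : nat) (k : 'I_r) : 'I_r.+1 := widen_ord (leqnSn r) k.
Definition last_colour (r : nat) : 'I_r.+1 := ord_max.

(* Colour of the edge (m, n). The value at m = n is junk, as (m, m) is not an
   edge. *)
Definition cube_colouring (r : nat) (l : 'I_r -> nat) (U : cube_partition l)
    (m n : posnat) : 'I_r.+1 :=
  let i := index_of U m in
  let j := index_of U n in
  if first_difference i j is Some k then
    if (i k < j k)%N then last_colour r else colour k
  else last_colour r.

(* [FinPath x s] is the vertex sequence x :: s, with [size s] edges. *)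
Inductive vertex_sequence : Type :=
  | FinPath of posnat & seq posnat
  | InfPath of (nat -> posnat).

Definition vertices (p : vertex_sequence) : set posnat :=
  match p with
  | FinPath x s => [set y | y \in x :: s]
  | InfPath v => range v
  end.

Definition has_length (p : vertex_sequence) (n : nat) : Prop :=
  match p with
  | FinPath _ s => size s = n
  | InfPath _ => False
  end.

Definition follows (e : rel posnat) (p : vertex_sequence) : Prop :=
  match p with
  | FinPath x s => path e x s
  | InfPath v => forall n, e (v n) (v n.+1)
  end.

Definition distinct_vertices (p : vertex_sequence) : Prop :=
  match p with
  | FinPath x s => uniq (x :: s)
  | InfPath v => injective v
  end.

(* Either all edges (v_i, v_(i+1)) or all edges (v_(i+1), v_i) have colour a;
   these pairs are edges because the vertices are distinct. *)
Definition monochromatic_path (r : nat) (c : posnat -> posnat -> 'I_r.+1)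
    (a : 'I_r.+1) (p : vertex_sequence) : Prop :=
  distinct_vertices p /\
  (follows (fun m n => c m n == a) p \/ follows (fun m n => c n m == a) p).

(* Main.v *)
Require Import Defs.
From mathcomp Require Import all_boot all_order all_algebra.
From mathcomp Require Import all_classical all_reals all_analysis.

(** Along an edge of colour [i] the [i]-th coordinate of the class index is
    strictly monotone, so a path in colour [i] has at most [l i] vertices.
    Along an edge of the last colour the class index is constant or moves up in
    the lexicographic order of a finite set, so an infinite path in that colour
    stays in a single class from some vertex on, and its upper density is at
    most the common density of the classes, which is the inverse of their
    number. *)

Import Order.TTheory GRing.Theory Num.Theory.
Import numFieldNormedType.Exports.

Local Open Scope ring_scope.

(** * Monotone sequences *)

Lemma path_ltn_last (T : Type) (h : T -> nat) (x : T) (s : seq T) :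
  path (fun a b => h a < h b)%N x s -> (h x + size s <= h (last x s))%N.
Proof.
elim: s x => [|y s IHs] x /=; first by rewrite addn0.
move=> /andP[hxy /IHs]; apply: leq_trans.
by rewrite addnS -addSn leq_add2r.
Qed.

Lemma path_gtn_last (T : Type) (h : T -> nat) (x : T) (s : seq T) :
  path (fun a b => h b < h a)%N x s -> (h (last x s) + size s <= h x)%N.
Proof.
elim: s x => [|y s IHs] x /=; first by rewrite addn0.
by move=> /andP[hxy /IHs le_y]; rewrite addnS; exact: leq_ltn_trans hxy.
Qed.

(** The number of [e]-predecessors strictly increases along [e], by transitivity and irreflexivity,
    and never exceeds [#|T|]. Once it attains its maximum along [f], no strict step remains. *)
Lemma monotone_eventually_constant (T : finType) (e : rel T) (f : nat -> T) :
  irreflexive e -> transitive e ->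
  (forall n, f n = f n.+1 \/ e (f n) (f n.+1)) ->
  exists N, forall n, (N <= n)%N -> f n = f N.
Proof.
move=> irr_e tr_e mono_f; pose rank y := #|[pred x | e x y]|.
have lt_rank x y : e x y -> (rank x < rank y)%N.
  move=> exy; apply/proper_card/properP; split.
    by apply/fintype.subsetP => z; rewrite !inE => /tr_e; apply.
  by exists x; rewrite !inE // irr_e.
pose P k := `[< exists n, rank (f n) = k >].
have exP : exists k, P k by exists (rank (f 0%N)); apply/asboolP; exists 0%N.
have ubP k : P k -> (k <= #|T|)%N by move=> /asboolP[n <-]; exact: max_card.
case: (ex_maxnP exP ubP) => _ /asboolP[N <-] maxN; exists N.
elim=> [|n IHn]; first by rewrite leqn0 => /eqP->.
rewrite leq_eqVlt ltnS => /orP[/eqP-> // | /IHn fnN].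
have [<- // | /lt_rank] := mono_f n.
by rewrite fnN ltnNge maxN //; apply/asboolP; exists n.+1.
Qed.

(** * The lexicographic order on class indices *)

Definition lex_lt {r : nat} {l : 'I_r -> nat} : rel (cube_index l) :=
  fun i j => [exists k : 'I_r, (i k < j k)%N &&
                [forall k' : 'I_r, (k' < k)%N ==> (i k' == j k')]].

Lemma lex_lt_irr (r : nat) (l : 'I_r -> nat) : irreflexive (@lex_lt r l).
Proof. by move=> i; apply/existsP => -[k]; rewrite ltnn. Qed.

Lemma lex_lt_trans (r : nat) (l : 'I_r -> nat) : transitive (@lex_lt r l).
Proof.
move=> j i h /existsP[a /andP[ija /forallP eqa]].
move=> /existsP[b /andP[jhb /forallP eqb]]; apply/existsP.
have {}eqa (k : 'I_r) : (k < a)%N -> i k = j k.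
  by move=> ka; exact/eqP/(implyP (eqa k)).
have {}eqb (k : 'I_r) : (k < b)%N -> j k = h k.
  by move=> kb; exact/eqP/(implyP (eqb k)).
(* The smaller of the two deciding coordinates [a] and [b] decides between [i] and [h]. *)
case: (ltngtP a b) => [ab|ba|/val_inj ab].
- exists a; rewrite -eqb // ija; apply/forallP => k; apply/implyP => ka.
  by rewrite eqa // eqb // (ltn_trans ka).
- exists b; rewrite eqa // jhb; apply/forallP => k; apply/implyP => kb.
  by rewrite eqa ?eqb // (ltn_trans kb).
- exists b; rewrite -ab in jhb eqb *; rewrite (ltn_trans ija jhb).
  by apply/forallP => k; apply/implyP => ka; rewrite eqa ?eqb.
Qed.

(** * Edges and paths of the cube colouring *)

Section CubePartition.
Variables (r : nat) (l : 'I_r -> nat) (U : cube_partition l).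

Lemma cube_classE (i : cube_index l) (m : posnat) :
  U i m <-> index_of U m = i.
Proof.
have Um : U (index_of U m) m by rewrite /index_of; case: cid.
split=> [Uim|<-//]; have [_ tU _] := cube_class_partition U.
by apply: tU => //; exists m.
Qed.

(** Colour [k] arises only when [k] is the first differing coordinate and does not increase from [m]
    to [n]; as it differs, it drops. *)
Lemma cube_colouring_colour (k : 'I_r) (m n : posnat) :
  cube_colouring U m n = colour k -> (index_of U n k < index_of U m k)%N.
Proof.
have ne_last (k' : 'I_r) : last_colour r <> colour k'.
  by move=> /(congr1 val) /= E; have := ltn_ord k'; rewrite -E ltnn.
rewrite /cube_colouring /first_difference.
case: pickP => [k' /andP[neq _]|_ /ne_last//].
case: ifPn => [_ /ne_last//|]; rewrite -leqNgt => le_nm /(congr1 val) /= E.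
have {}E : k' = k by exact: val_inj.
by rewrite -E ltn_neqAle le_nm andbT eq_sym.
Qed.

Lemma cube_colouring_last (m n : posnat) :
  cube_colouring U m n = last_colour r ->
  index_of U m = index_of U n \/ lex_lt (index_of U m) (index_of U n).
Proof.
rewrite /cube_colouring /first_difference.
set i := index_of U m; set j := index_of U n.
case: pickP => [k /andP[_ /forallP fst_k]|no_diff _].
  case: ifPn => [lt_k _|_ /(congr1 val) /= E]; last first.
    by have := ltn_ord k; rewrite {1}E ltnn.
  right; apply/existsP; exists k; rewrite lt_k; apply/forallP => k'.
  apply/implyP; apply: contraLR => neq.
  by rewrite -leqNgt; exact: implyP (fst_k k') neq.
left; apply/ffunP => k0; apply/eqP/negPn/negP => neq0.
(* If the indices differed somewhere, the least differing coordinate would have been found by the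
   [pick]. *)
case: (@arg_minnP _ k0 (fun k => i k != j k) (fun k => k) neq0) => k neq min_k.
have /negP[] := negbT (no_diff k); rewrite neq.
by apply/forallP => k'; apply/implyP => /min_k.
Qed.

(** The [k]-th coordinate changes by at least one per edge, always in the same direction, so [l k]
    edges would force a value of at least [l k] at one end of the path. *)
Lemma no_long_path_colour (k : 'I_r) (p : vertex_sequence) :
  monochromatic_path (cube_colouring U) (colour k) p -> ~ has_length p (l k).
Proof.
pose h m : nat := index_of U m k.
case: p => [x s [_ path_s] /= size_s|v _ //].
have h_lt y : (h y < l k)%N by exact: ltn_ord.
case: path_s => /= path_s.
- have mono_h : path (fun a b => h b < h a)%N x s.
    by apply: sub_path path_s => a b /eqP; exact: cube_colouring_colour.
  have := path_gtn_last _ h _ _ mono_h; rewrite size_s.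
  by move=> /(leq_trans (leq_addl _ _)); rewrite leqNgt h_lt.
- have mono_h : path (fun a b => h a < h b)%N x s.
    by apply: sub_path path_s => a b /eqP; exact: cube_colouring_colour.
  have := path_ltn_last _ h _ _ mono_h; rewrite size_s.
  by move=> /(leq_trans (leq_addl _ _)); rewrite leqNgt h_lt.
Qed.

Lemma last_colour_path_almost_in_class (p : vertex_sequence) :
  monochromatic_path (cube_colouring U) (last_colour r) p ->
  exists (s : seq posnat) (i : cube_index l),
    (vertices p `<=` [set` s] `|` U i)%classic.
Proof.
case: p => [x s _|v [_ /= path_v]].
  (* A finite path is covered by its own vertex list, so any class serves; that of [x] is at
     hand. *)
  by exists (x :: s), (index_of U x) => y ys; left.
have [N constN] : exists N, forall n, (N <= n)%N ->
    index_of U (v n) = index_of U (v N).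
  case: path_v => path_v.
    apply: (@monotone_eventually_constant _ (@lex_lt r l)
              (fun n => index_of U (v n))).
    - exact: lex_lt_irr.
    - exact: lex_lt_trans.
    - by move=> n; apply: cube_colouring_last; exact/eqP.
  (* On a path traversed against its edges the index descends, so the converse order is used. *)
  apply: (@monotone_eventually_constant _ (fun i j => @lex_lt r l j i)
            (fun n => index_of U (v n))).
  - exact: lex_lt_irr.
  - by move=> j i h ij jh; exact: lex_lt_trans jh ij.
  - by move=> n; have /eqP/cube_colouring_last[] := path_v n; [left|right].
exists [seq v n | n <- iota 0 N], (index_of U (v N)) => _ [n _ <-].
have [lt_nN|le_Nn] := ltnP n N.
  by left => /=; apply: map_f; rewrite mem_iota.
by right; apply/cube_classE; exact: constN.
Qed.

(** * Densities *)

Lemma sum_density_upto (R : realType) (n : nat) :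
  \sum_(i : cube_index l) density_upto R (U i) n.+1 = 1.
Proof.
rewrite /density_upto -mulr_suml -natr_sum.
suff -> : (\sum_(i : cube_index l)
    #|[pred k : 'I_n.+1 | `[< U i (posnat_of k) >]]|)%N = n.+1.
  by rewrite divff // pnatr_eq0.
under eq_bigr do rewrite -sum1_card.
(* Double counting: each of the first [n.+1] positive integers is counted once, for the one class
   containing it. *)
rewrite (exchange_big_dep predT) //=.
rewrite -[RHS]card_ord -sum1_card; apply: eq_bigr => k _.
rewrite (big_pred1 (index_of U (posnat_of k))) // => i /=.
rewrite inE; apply/asboolP/eqP; first by move=> /cube_classE.
by move=> ->; exact/cube_classE.
Qed.

(** The sum of the class densities up to [n] tends both to 1 and to [d] times the number of
    classes. *)
Lemma equal_density_value (R : realType) (d : R) :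
  (forall i : cube_index l, has_density (U i) d) ->
  d = \prod_(k < r) (l k)%:R^-1.
Proof.
move=> Ud.
have sum_d : (\sum_(i : cube_index l) density_upto R (U i) n @[n --> \oo]
    --> \sum_(i : cube_index l) d)%classic.
  by apply: cvg_big => [|i _]; [exact: add_continuous|exact: Ud].
have sum_1 : (\sum_(i : cube_index l) density_upto R (U i) n @[n --> \oo]
    --> (1 : R))%classic.
  (* The shift discards [n = 0], where division by zero makes the sum 0 instead of 1. *)
  rewrite -(cvg_shiftS
    (fun n => \sum_(i : cube_index l) density_upto R (U i) n)).
  by under eq_fun do rewrite sum_density_upto; exact: cvg_cst.
have := cvg_unique (@norm_hausdorff _ R) sum_d sum_1.
have card_index : #|{: cube_index l}| = (\prod_(k < r) l k)%N.
  rewrite card_dep_ffun foldrE big_image /=.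
  by apply: eq_bigr => k _; rewrite card_ord.
rewrite sumr_const card_index -mulr_natr natr_prod prodfV => d1.
(* A zero product would turn [d1] into [0 = 1]. *)
have prod_neq0 : \prod_(k < r) (l k)%:R != 0 :> R.
  by apply: contra_neq (oner_neq0 R) => prod0; rewrite -d1 prod0 mulr0.
by apply: (mulIf prod_neq0); rewrite d1 mulVf.
Qed.

End CubePartition.

(** The exceptional set [s] adds at most [size s / n] to the density up to [n], and this tends to
    0. *)
Lemma upper_density_le_almost_subset (R : realType) (A B : set posnat)
    (s : seq posnat) (d : R) :
  (A `<=` [set` s] `|` B)%classic -> has_density B d ->
  (upper_density R A <= d%:E)%E.
Proof.
move=> AsB Bd.
pose u (n : nat) : R := (size s)%:R / n%:R + density_upto R B n.
have ud : (u n @[n --> \oo] --> d)%classic.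
  rewrite -[d]add0r; apply: cvgD => //.
  have size_cst : ((size s)%:R @[n --> (\oo : set_system nat)]
      --> ((size s)%:R : R))%classic.
    exact: cvg_cst.
  rewrite -cvg_shiftS; have := cvgM size_cst cvg_harmonic.
  by rewrite mulr0; apply.
have le_u n : density_upto R A n <= u n.
  rewrite /u /density_upto -mulrDl ler_wpM2r ?invr_ge0 ?ler0n // -natrD ler_nat.
  (* Position [k] stands for the integer [k + 1], so [K] lists the positions of the elements of
     [s]. *)
  pose K := [seq (val m).-1 | m <- s].
  have card_s : (#|[pred k : 'I_n | val k \in K]| <= size s)%N.
    rewrite -(size_map (fun m => (val m).-1) s) -/K cardE -(size_map val).
    apply: uniq_leq_size; first by rewrite (map_inj_uniq val_inj) enum_uniq.
    by move=> _ /mapP[k + ->]; rewrite mem_enum.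
  apply: leq_trans (leq_add card_s (leqnn _)); rewrite -cardUI.
  apply: leq_trans (leq_addr _ _); apply: subset_leq_card.
  apply/fintype.subsetP => k; rewrite !inE => Ak.
  have [/= ks|kB] := AsB _ Ak.
    by apply/orP; left; apply/mapP; exists (posnat_of k).
  by apply/orP; right; exact/asboolP.
rewrite /upper_density limn_esup_lim.
have uE : ((u n)%:E @[n --> \oo] --> d%:E)%classic
  by apply: cvg_EFin => //; exact: nearW.
(* Since [u] converges, its tail suprema also tend to [d], and they dominate those of the density of
   [A] term by term. *)
have u_sup := cvg_esups uE.
rewrite -(cvg_lim _ u_sup) //; apply: lee_lim.
- exact: is_cvg_esups.
- exact: is_cvg_esups.
- apply: nearW => n; apply: ge_ereal_sup => _ [m /= le_nm <-].
  apply: (@le_trans _ _ (u m)%:E); first by rewrite lee_fin.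
  by apply: ereal_sup_ubound; exists m.
Qed.

Theorem theorem3p6 (R : realType) (r : nat) (l : 'I_r -> nat)
    (hl : forall k : 'I_r, (0 < l k)%N)
    (U : cube_partition l) (hU : equally_dense R U) :
  (forall i : 'I_r,
     ~ exists p : vertex_sequence,
         monochromatic_path (cube_colouring U) (colour i) p /\
         has_length p (l i)) /\
  (forall p : vertex_sequence,
     monochromatic_path (cube_colouring U) (last_colour r) p ->
     (upper_density R (vertices p) <= (\prod_(i < r) (l i)%:R^-1)%:E)%E).
Proof.
split=> [i [p [mono_p]]|p mono_p]; first exact: no_long_path_colour mono_p.
have [d Ud] := hU; rewrite -(equal_density_value _ _ U _ _ Ud).
have [s [i sub_p]] := last_colour_path_almost_in_class _ _ _ _ mono_p.
exact: upper_density_le_almost_subset sub_p (Ud i).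
Qed.
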